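(* The $C^*$-algebras $\mathcal{O}_{\mathbb{P}^1_{\mathrm{Berk}}(\mathbb{C}_p)}$ and $\mathcal{O}_{\mathbb{H}^{\mathbb{Q}}_{\mathrm{Berk}}(\mathbb{C}_p)}$ are $*$-isomorphic.
   Context: Let $\mathbb{Q}_1=\mathbb{Q}\cap(0,1)$, enumerated as $(q_n)_{n\ge1}$, and let $b_n\in[0,1]$ with $q_n<b_n$ and $b_n-q_n\to0$. Let $f:[0,1]\to2^{[0,1]}$ be the set-valued (comb) function with graph $\{(t,t):t\in[0,1]\}\cup\bigcup_n[q_n,b_n]\times\{q_n\}$, and $X=\{(x_1,x_2,\dots)\in[0,1]^{\mathbb{N}}:x_k\in f(x_{k+1})\ \forall k\}$. This is homeomorphic to Ważewski's universal dendrite, with which $\mathbb{P}^1_{\mathrm{Berk}}(\mathbb{C}_p)$ is identified, so points of $\mathbb{P}^1_{\mathrm{Berk}}(\mathbb{C}_p)$ are the sequences in $X$. The set of type II (branching) points is $$\mathbb{H}^{\mathbb{Q}}_{\mathrm{Berk}}(\mathbb{C}_p)=\{x\in X: x=(q_{i_1}^{k_1},\dots,q_{i_{m-1}}^{k_{m-1}},q_{i_m}^\infty),\ q_{i_\ell}<q_{i_{\ell+1}}\}\subseteq\mathbb{Q}_1^{\mathbb{N}},$$ where $a^k$ means $a$ repeated $k>0$ times. Let $\mathcal{L}$ be the language of $\mathbb{H}^{\mathbb{Q}}_{\mathrm{Berk}}(\mathbb{C}_p)$: the set of finite words in $\mathbb{Q}_1$ (including the empty word $\emptyset$) that appear in some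 sequence of $\mathbb{H}^{\mathbb{Q}}_{\mathrm{Berk}}(\mathbb{C}_p)$. For $\mathsf{X}$ equal to either $\mathbb{H}^{\mathbb{Q}}_{\mathrm{Berk}}(\mathbb{C}_p)$ or $\mathbb{P}^1_{\mathrm{Berk}}(\mathbb{C}_p)$ and $\alpha,\beta\in\mathcal{L}$ put $C(\alpha,\beta)=\{\beta x\in\mathsf{X}:\alpha x\in\mathsf{X}\}$, and let $\mathcal{B}_{\mathsf{X}}$ be the Boolean algebra of subsets of $\mathsf{X}$ generated by all $C(\alpha,\beta)$, $\alpha,\beta\in\mathcal{L}$. $\mathcal{O}_{\mathsf{X}}$ is the universal unital $C^*$-algebra generated by projections $\{p_A:A\in\mathcal{B}_{\mathsf{X}}\}$ and partial isometries $\{s_a:a\in\mathbb{Q}_1\}$ subject to: (1) $p_{\mathsf{X}}=1$, $p_{A\cap B}=p_Ap_B$, $p_{A\cup B}=p_A+p_B-p_{A\cap B}$, $p_\emptyset=0$ for $A,B\in\mathcal{B}_{\mathsf{X}}$; (2) $s_\beta s_\alpha^*s_\alpha s_\beta^*=p_{C(\alpha,\beta)}$ for all $\alpha,\beta\in\mathcal{L}$, where $s_\emptyset=1$ and $s_\alpha=s_{\alpha_1}\cdots s_{\alpha_n}$ for $\alpha=\alpha_1\cdots\alpha_n$. *)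

(* Defs.v *)
From HB Require Import structures.
From mathcomp Require Import all_boot all_order all_algebra.
From mathcomp Require Import complex.
From mathcomp Require Import all_classical all_reals all_analysis.

Set Implicit Arguments.
Unset Strict Implicit.
Unset Printing Implicit Defensive.

Import Order.TTheory GRing.Theory Num.Theory.
Import numFieldNormedType.Exports.

Local Open Scope classical_set_scope.
Local Open Scope ring_scope.

(* MathComp-Analysis cannot put its norm on a type that is also an algebra:
   Hierarchy Builder rejects any join of rings and normed modules that is not
   below numDomainType.  The norm is therefore a field of its own. *)
HB.mixin Record isCStarAlgebra (R : realType) A & GRing.Algebra R[i] A := {
  cnorm : A -> R ;
  cnorm_eq0 : forall x : A, cnorm x = 0 -> x = 0 ;
  cnormD : forall x y : A, cnorm (x + y) <= cnorm x + cnorm y ;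
  cnormZ : forall (c : R[i]) (x : A), cnorm (c *: x) = ComplexField.Normc.normc c * cnorm x ;
  cnormM : forall x y : A, cnorm (x * y) <= cnorm x * cnorm y ;
  cnorm_complete : forall u : nat -> A,
    (forall e : R, 0 < e -> exists N, forall m n, (N <= m)%N -> (N <= n)%N ->
      cnorm (u m - u n) < e) ->
    exists l : A, forall e : R, 0 < e -> exists N, forall n, (N <= n)%N ->
      cnorm (u n - l) < e ;
  star : A -> A ;
  starD : forall x y : A, star (x + y) = star x + star y ;
  starZ : forall (c : R[i]) (x : A), star (c *: x) = conjc c *: star x ;
  starM : forall x y : A, star (x * y) = star y * star x ;
  starK : forall x : A, star (star x) = x ;
  cstar_identity : forall x : A, cnorm (star x * x) = cnorm x ^+ 2
}.

(* MathComp rings satisfy 1 != 0, so these are the nonzero unital C*-algebras. *)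
#[short(type="cstarAlgType")]
HB.structure Definition CStarAlgebra (R : realType) :=
  {A of GRing.Algebra R[i] A & isCStarAlgebra R A}.

Section cstar_notions.
Context {R : realType}.
Implicit Types A B : cstarAlgType R.

Definition projection A (p : A) := star p = p /\ p * p = p.

Definition partial_isometry A (s : A) := projection (star s * s).

Definition star_morphism A B (f : {lrmorphism A -> B}) :=
  forall x, f (star x) = star (f x).

Definition star_isomorphic A B :=
  exists f : {lrmorphism A -> B}, star_morphism f /\ bijective f.

End cstar_notions.

Definition Q1 := {r : rat | 0 < r < 1}.

Section sequences_and_words.
Context {R : realType}.

Definition Q1R (a : Q1) : R := ratr (val a).

Definition word_cat (w : seq Q1) (x : nat -> R) : nat -> R :=
  fun k => nth (x (k - size w)%N) [seq Q1R a | a <- w] k.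

Section comb.
Variables (q : nat -> Q1) (b : nat -> R).

Definition comb_graph : set (R * R) :=
  [set u | u.1 \in `[0, 1] /\ u.2 = u.1] `|`
  \bigcup_n [set u | u.1 \in `[Q1R (q n), b n] /\ u.2 = Q1R (q n)].

Definition comb (t : R) : set R := [set y | comb_graph (t, y)].

Definition P1Berk : set (nat -> R) :=
  [set x | forall k, x k \in `[0, 1] /\ comb (x k.+1) (x k)].

(* The pairs in w are the (q_{i_l}, k_l) for l < m, and a is q_{i_m}. *)
Definition HQBerk : set (nat -> R) :=
  [set x | P1Berk x /\
    exists (w : seq (Q1 * nat)) (a : Q1),
      [/\ all (fun u => 0 < u.2)%N w,
          sorted (fun c d : Q1 => val c < val d) (rcons (unzip1 w) a) &
          x = word_cat (flatten [seq nseq u.2 u.1 | u <- w])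
                       (fun=> Q1R a)]].

Definition language : set (seq Q1) :=
  [set w | exists2 x, HQBerk x &
    exists n, forall j, (j < size w)%N ->
      x (n + j)%N = nth 0 [seq Q1R a | a <- w] j].

End comb.

Definition cylinder (X : set (nat -> R)) (alpha beta : seq Q1) :
    set (nat -> R) :=
  [set y | exists x, [/\ y = word_cat beta x, X (word_cat beta x) &
                         X (word_cat alpha x)]].

End sequences_and_words.

Definition boolean_algebra_on T (X : set T) (B : set (set T)) :=
  [/\ forall A, B A -> A `<=` X,
      B X,
      setU_closed B,
      setI_closed B &
      forall A, B A -> B (X `\` A)].

Section subshift_algebra.
Context {R : realType}.
Variables (X : set (nat -> R)) (L : set (seq Q1)).

Definition cylinder_algebra : set (set (nat -> R)) :=
  smallest (boolean_algebra_on X)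
    [set A | exists alpha beta,
       [/\ L alpha, L beta & A = cylinder X alpha beta]].

Definition word_elt (A : cstarAlgType R) (s : Q1 -> A) (w : seq Q1) : A :=
  \prod_(a <- w) s a.

(* Only the values of p on cylinder_algebra are meaningful. *)
Record subshift_family (A : cstarAlgType R)
    (p : set (nat -> R) -> A) (s : Q1 -> A) : Prop := {
  family_projection : forall E, cylinder_algebra E -> projection (p E) ;
  family_partial_isometry : forall a, partial_isometry (s a) ;
  family_one : p X = 1 ;
  family_setI : forall E F, cylinder_algebra E -> cylinder_algebra F ->
    p (E `&` F) = p E * p F ;
  family_setU : forall E F, cylinder_algebra E -> cylinder_algebra F ->
    p (E `|` F) = p E + p F - p (E `&` F) ;
  family_set0 : p set0 = 0 ;
  family_cylinder : forall alpha beta, L alpha -> L beta ->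
    word_elt s beta * star (word_elt s alpha)
      * word_elt s alpha * star (word_elt s beta)
    = p (cylinder X alpha beta)
}.

Definition family_morphism (A B : cstarAlgType R)
    (p : set (nat -> R) -> A) (s : Q1 -> A)
    (p' : set (nat -> R) -> B) (s' : Q1 -> B) (f : {lrmorphism A -> B}) :=
  [/\ star_morphism f,
      forall E, cylinder_algebra E -> f (p E) = p' E &
      forall a, f (s a) = s' a].

Definition universal_algebra (A : cstarAlgType R)
    (p : set (nat -> R) -> A) (s : Q1 -> A) : Prop :=
  subshift_family p s /\
  forall (B : cstarAlgType R) (p' : set (nat -> R) -> B) (s' : Q1 -> B),
    subshift_family p' s' ->
    exists f : {lrmorphism A -> B}, family_morphism p s p' s' f /\
      forall g : {lrmorphism A -> B}, family_morphism p s p' s' g -> g =1 f.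

End subshift_algebra.

(* Main.v *)
Require Import Defs.
From HB Require Import structures.
From mathcomp Require Import all_boot all_order all_algebra.
From mathcomp Require Import complex.
From mathcomp Require Import all_classical all_reals all_analysis.

Set Implicit Arguments.
Unset Strict Implicit.
Unset Printing Implicit Defensive.

Import Order.TTheory GRing.Theory Num.Theory.
Import numFieldNormedType.Exports.

Local Open Scope classical_set_scope.
Local Open Scope ring_scope.

(** The space [H] of type II points sits inside the space [P] of all points,
    and [E |-> E `&` H] turns out to be an isomorphism from the Boolean algebra
    generated by the cylinders of [P] onto the one generated by the cylinders
    of [H], matching the cylinder of [(alpha, beta)] in [P] with the one in
    [H].  Since the two universal problems speak only of these Boolean algebras
    and of the shared language, they have the same solutions, and the
    comparison maps given by the universal properties are mutually inverse
    (universal_algebra_trace).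

    Two facts make the trace map an isomorphism.

    Traces of cylinders are cylinders (cylinder_HQBerk).  Sequences in [P] are
    weakly increasing, so a sequence of [P] lies in [H] as soon as its terms are
    rationals of (0,1) and it is eventually constant (HQBerkE); this property
    is insensitive to replacing a prefix [beta] by a prefix [alpha].

    The trace map is injective (cylinder_algebra_trace_eq0).  Whether a point
    [y] lies in a given set of the algebra depends only on finitely many bits,
    each asking whether [y k = a] or whether [a] is in [f (y k)], for a letter
    [a] (finitely_determined_cylinder_algebra).  Every point of [P] agrees with
    some point of [H] on any finite set of such bits (HQBerk_dense), so a
    nonempty set of the algebra meets [H].  Indeed the first term [t] outside
    Q1 of a sequence of [P] is repeated for ever, and can be replaced by a
    nearby rational, taken below [t] unless [t = 0]: the value [t] may be the
    right end [b n] of a tooth of the comb, in which case moving up would leave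
    the tooth, whereas it is never the left end [q n], which lies in Q1. *)

(** * Traces of cylinder algebras *)

Section cylinder_algebras.
Context {R : realType}.
Implicit Types (X : set (nat -> R)) (L : set (seq Q1)).

Lemma cylinder_sub X alpha beta : cylinder X alpha beta `<=` X.
Proof. by move=> _ [x [-> ]]. Qed.

Lemma cylinder_algebraP X L :
  boolean_algebra_on X (cylinder_algebra X L).
Proof.
split=> [A AX||E F XE XF|E F XE XF|A XA].
- apply: (AX [set E | E `<=` X]); split=> [|_ [al [be [_ _ ->]]]].
    split=> //= [E F EX FX|E F EX _].
    + by rewrite /= subUset.
    + exact: subset_trans (@subIsetl _ _ _) EX.
  exact: cylinder_sub.
- by move=> B [[]].
- move=> B [BB GB]; case: (BB) => _ _ BU _ _.
  by apply: BU; [apply: XE|apply: XF].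
- move=> B [BB GB]; case: (BB) => _ _ _ BI _.
  by apply: BI; [apply: XE|apply: XF].
- move=> B [BB GB]; case: (BB) => _ _ _ _ BD.
  by apply: BD; apply: XA.
Qed.

Lemma cylinder_algebra_cylinder X L alpha beta :
  L alpha -> L beta -> cylinder_algebra X L (cylinder X alpha beta).
Proof. by move=> La Lb B [_]; apply; exists alpha, beta. Qed.

Lemma cylinder_algebra_ind X L (B : set (set (nat -> R))) :
  boolean_algebra_on X B ->
  (forall alpha beta, L alpha -> L beta -> B (cylinder X alpha beta)) ->
  cylinder_algebra X L `<=` B.
Proof.
by move=> BB Bc; apply: smallest_sub => // _ [al [be [La Lb ->]]]; apply: Bc.
Qed.

End cylinder_algebras.

Section trace.
Context {R : realType}.
Variables (X Y : set (nat -> R)) (L : set (seq Q1)).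
Hypothesis YX : Y `<=` X.
Hypothesis trace_cylinder : forall alpha beta, L alpha -> L beta ->
  cylinder X alpha beta `&` Y = cylinder Y alpha beta.
Hypothesis trace_eq0 : forall E, cylinder_algebra X L E ->
  E `&` Y = set0 -> E = set0.

Lemma trace_setD E : (X `\` E) `&` Y = Y `\` (E `&` Y).
Proof.
apply/seteqP; split=> y /=; first by move=> [[_ nE] Yy]; split=> // -[].
by move=> [Yy nE]; split=> //; split=> [|Ey]; [exact: YX|exact: nE].
Qed.

Lemma trace_setI E F : (E `&` F) `&` Y = (E `&` Y) `&` (F `&` Y).
Proof. by rewrite setIACA setIid. Qed.

Lemma trace_cylinder_algebra E :
  cylinder_algebra X L E -> cylinder_algebra Y L (E `&` Y).
Proof.
move=> XE; have [sX XX XU XI XD] := cylinder_algebraP X L.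
have [sY YY YU YI YD] := cylinder_algebraP Y L.
suff: cylinder_algebra X L `<=`
    [set F | F `<=` X /\ cylinder_algebra Y L (F `&` Y)].
  by move=> /(_ _ XE)[].
apply: cylinder_algebra_ind => [|al be La Lb /=].
  split=> [F []//||F G [FX YF] [GX YG]|F G [FX YF] [GX YG]|F [FX YF]] /=.
  - by rewrite (setIidr YX); split.
  - by rewrite setIUl subUset; split=> //; exact: YU.
  - rewrite trace_setI; split; last exact: YI.
    exact: subset_trans (@subIsetl _ _ _) FX.
  - by rewrite trace_setD; split; [exact: subDsetl|exact: YD].
split; first exact: cylinder_sub.
by rewrite trace_cylinder//; exact: cylinder_algebra_cylinder.
Qed.

Lemma trace_cylinder_algebra_surj F : cylinder_algebra Y L F ->
  exists E, cylinder_algebra X L E /\ E `&` Y = F.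
Proof.
have [sX XX XU XI XD] := cylinder_algebraP X L.
move: F; apply: cylinder_algebra_ind => [|al be La Lb /=].
  split=> [_ [E [_ <-]]||_ _ [E [XE <-]] [F [XF <-]]|
           _ _ [E [XE <-]] [F [XF <-]]|_ [E [XE <-]]] //=.
  - by exists X; rewrite (setIidr YX).
  - by exists (E `|` F); rewrite setIUl; split=> //; exact: XU.
  - by exists (E `&` F); rewrite trace_setI; split=> //; exact: XI.
  - by exists (X `\` E); rewrite trace_setD; split=> //; exact: XD.
exists (cylinder X al be); rewrite trace_cylinder//; split=> //.
exact: cylinder_algebra_cylinder.
Qed.

Lemma trace_cylinder_algebra_inj E F :
  cylinder_algebra X L E -> cylinder_algebra X L F ->
  E `&` Y = F `&` Y -> E = F.
Proof.
have [sX XX XU XI XD] := cylinder_algebraP X L.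
suff H : forall A B, cylinder_algebra X L A -> cylinder_algebra X L B ->
    A `&` Y = B `&` Y -> A `<=` B.
  by move=> XE XF EF; apply/seteqP; split; apply: H.
move=> A B XA XB AB x Ax; apply: contrapT => nB.
have : (A `&` (X `\` B)) x by split=> //; split=> //; exact: sX XA _ Ax.
suff -> : A `&` (X `\` B) = set0 by [].
apply: trace_eq0; first by apply: XI => //; exact: XD.
by rewrite trace_setI trace_setD AB; apply/seteqP; split=> // y [? []].
Qed.

Definition untrace (F : set (nat -> R)) : set (nat -> R) :=
  xget set0 [set E | cylinder_algebra X L E /\ E `&` Y = F].

Lemma untraceP F : cylinder_algebra Y L F ->
  cylinder_algebra X L (untrace F) /\ untrace F `&` Y = F.
Proof. by move=> /trace_cylinder_algebra_surj; exact: xgetPex. Qed.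

Lemma untraceK E : cylinder_algebra X L E -> untrace (E `&` Y) = E.
Proof.
move=> XE; have [XuE uE] := untraceP (trace_cylinder_algebra XE).
exact: trace_cylinder_algebra_inj.
Qed.

Lemma subshift_family_trace (A : cstarAlgType R)
    (p : set (nat -> R) -> A) (s : Q1 -> A) :
  subshift_family Y L p s -> subshift_family X L (fun E => p (E `&` Y)) s.
Proof.
move=> [pP sP p1 pI pU p0 pC]; split=> //=.
- by move=> E /trace_cylinder_algebra; exact: pP.
- by rewrite (setIidr YX).
- by move=> E F XE XF; rewrite trace_setI pI//; exact: trace_cylinder_algebra.
- move=> E F XE XF; rewrite setIUl trace_setI pU//;
    exact: trace_cylinder_algebra.
- by rewrite set0I.
- by move=> al be La Lb; rewrite trace_cylinder// pC.
Qed.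

Lemma subshift_family_untrace (A : cstarAlgType R)
    (p : set (nat -> R) -> A) (s : Q1 -> A) :
  subshift_family X L p s -> subshift_family Y L (p \o untrace) s.
Proof.
have [sX XX XU XI XD] := cylinder_algebraP X L.
move=> [pP sP p1 pI pU p0 pC]; split=> //=.
- by move=> E /untraceP[/pP].
- by rewrite -[in LHS](setIidr YX) untraceK.
- move=> E F /untraceP[XE uE] /untraceP[XF uF].
  by rewrite -pI// -[in LHS]uE -[in LHS]uF -trace_setI untraceK//; exact: XI.
- move=> E F /untraceP[XE uE] /untraceP[XF uF].
  rewrite -[in LHS]uE -[in LHS]uF -[in X in _ - X]uE -[in X in _ - X]uF.
  rewrite -trace_setI -setIUl untraceK; last exact: XU.
  by rewrite untraceK ?pU//; exact: XI.
- by rewrite -(set0I Y) untraceK// -(setDv X); exact: XD.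
- move=> al be La Lb; rewrite -trace_cylinder// untraceK ?pC//.
  exact: cylinder_algebra_cylinder.
Qed.

(** Families over [X] and families over [Y] are the same thing, so each algebra
    is generated by a family of the other kind; both composites of the induced
    morphisms fix the generators, hence are identities by uniqueness. *)
Lemma universal_algebra_trace (A B : cstarAlgType R)
    (pA : set (nat -> R) -> A) (sA : Q1 -> A)
    (pB : set (nat -> R) -> B) (sB : Q1 -> B) :
  universal_algebra X L pA sA -> universal_algebra Y L pB sB ->
  star_isomorphic A B.
Proof.
move=> [famA univA] [famB univB].
have [f [[fstar fp fs] _]] := univA _ _ _ (subshift_family_trace famB).
have [g [[gstar gp gs] _]] := univB _ _ _ (subshift_family_untrace famA).
have [hA [_ hAuniq]] := univA _ _ _ famA.
have [hB [_ hBuniq]] := univB _ _ _ famB.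
exists f; split=> //; exists g => x.
- transitivity (hA x); last by symmetry; apply: (hAuniq idfun).
  apply: (hAuniq (g \o f)); split=> [y|E XE|a] /=.
  + by rewrite fstar gstar.
  + by rewrite fp// gp/= ?untraceK//; exact: trace_cylinder_algebra.
  + by rewrite fs gs.
- transitivity (hB x); last by symmetry; apply: (hBuniq idfun).
  apply: (hBuniq (f \o g)); split=> [y|F YF|a] /=.
  + by rewrite gstar fstar.
  + by have [XuF uF] := untraceP YF; rewrite gp//= fp// uF.
  + by rewrite gs fs.
Qed.

End trace.

(** * Words and sequences *)

Section words.
Context {R : realType}.
Implicit Types (a : Q1) (w : seq Q1) (x y : nat -> R).

Lemma Q1R_gt0 a : 0 < Q1R a :> R.
Proof. by rewrite /Q1R ltr0q; case/andP: (valP a). Qed.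

Lemma Q1R_lt1 a : Q1R a < 1 :> R.
Proof. by rewrite /Q1R -(rmorph1 (@ratr R)) ltr_rat; case/andP: (valP a). Qed.

Lemma Q1R_itv a : Q1R a \in `[0 : R, 1].
Proof. by rewrite in_itv/= !ltW ?Q1R_gt0 ?Q1R_lt1. Qed.

Lemma Q1R_inj : injective (@Q1R R).
Proof. by move=> a c /fmorph_inj /val_inj. Qed.

Lemma ltQ1R a c : (Q1R a < Q1R c :> R) = (val a < val c).
Proof. exact: ltr_rat. Qed.

Lemma word_cat_nil x : word_cat [::] x = x.
Proof. by apply/funext => k; rewrite /word_cat nth_nil subn0. Qed.

Lemma word_cat_cons0 a w x : word_cat (a :: w) x 0%N = Q1R a.
Proof. by []. Qed.

Lemma word_cat_consS a w x k : word_cat (a :: w) x k.+1 = word_cat w x k.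
Proof. by rewrite /word_cat /= subSS. Qed.

Lemma word_cat_cat v w x : word_cat (v ++ w) x = word_cat v (word_cat w x).
Proof.
elim: v => [|a v IHv]; first by rewrite word_cat_nil.
by apply/funext => -[|k] //; rewrite !word_cat_consS IHv.
Qed.

Lemma word_cat_shift w x k : word_cat w x (size w + k) = x k.
Proof. by elim: w => [|a w IHw]; rewrite ?word_cat_nil// word_cat_consS. Qed.

End words.

(** * Points of the dendrite *)

Section dendrite.
Context {R : realType}.
Variables (q : nat -> Q1) (b : nat -> R).
Hypothesis q_enum : bijective q.
Hypothesis ltqb : forall n, Q1R (q n) < b n.
Implicit Types (a c : Q1) (w : seq Q1) (x y : nat -> R) (t : R).

Notation P := (P1Berk q b).
Notation H := (HQBerk q b).

Lemma comb_refl t : t \in `[0, 1] -> comb q b t t.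
Proof. by move=> t01; left. Qed.

Lemma comb_le t u : comb q b t u -> u <= t.
Proof.
case=> [[_ /= ->//]|[n _ [/= + ->]]].
by rewrite in_itv => /andP[].
Qed.

(** Outside Q1 only the diagonal of the comb is left. *)
Lemma comb_notin_Q1 t u : comb q b t u -> (forall a, u <> Q1R a) -> t = u.
Proof. by case=> [[]//|[n _ [_ /= ->]] /(_ (q n))]. Qed.

Lemma comb_q t n :
  comb q b t (Q1R (q n)) <-> t \in `[Q1R (q n), b n].
Proof.
split=> [[[_ /= <-]|[m _ [/= + /Q1R_inj /(bij_inj q_enum) ->]]]//|tn].
  by rewrite in_itv/= lexx ltW.
by right; exists n.
Qed.

Lemma P1BerkS x : P x -> P (fun k => x k.+1).
Proof. by move=> Px k; exact: Px. Qed.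

Lemma P1Berk_cons a x :
  P (word_cat [:: a] x) <-> comb q b (x 0%N) (Q1R a) /\ P x.
Proof.
have xS k : word_cat [:: a] x k.+1 = x k by rewrite word_cat_consS word_cat_nil.
split=> [Pax|[xa Px] [|k]].
- split; first by have [_] := Pax 0%N; rewrite xS.
  by move=> k; have := Pax k.+1; rewrite !xS.
- by rewrite xS; split=> //; exact: Q1R_itv.
- by rewrite !xS; exact: Px.
Qed.

Lemma P1Berk_const t : t \in `[0, 1] -> P (fun=> t).
Proof. by move=> t01 k; split=> //; exact: comb_refl. Qed.

Lemma P1Berk_notin_Q1 y : P y -> (forall a, y 0%N <> Q1R a) ->
  y = (fun=> y 0%N).
Proof.
move=> Py y0; apply/funext; elim=> [//|k IHk].
by rewrite -IHk; apply: comb_notin_Q1; [case: (Py k)|rewrite IHk].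
Qed.

(** Monotonicity of the sequences in [P] lets any eventually constant word be
    rewritten in run-length form with strictly increasing letters. *)
Lemma HQBerkE x :
  H x <-> P x /\ exists w a, x = word_cat w (fun=> Q1R a).
Proof.
split=> [[Px [w [a [_ _ xE]]]]|[Px [w [a xE]]]].
  by split=> //; exists (flatten [seq nseq u.2 u.1 | u <- w]), a.
split=> //; elim: w x Px xE => [|c w IHw] x Px xE.
  by exists [::], a; split.
have Pt : P (word_cat w (fun=> Q1R a)).
  move: Px; rewrite xE -cat1s word_cat_cat.
  by move=> /P1Berk_cons[].
have [l [d [l0 ld wE]]] := IHw _ Pt erefl.
have /comb_le : comb q b (x 1%N) (x 0%N) by case: (Px 0%N).
rewrite xE word_cat_cons0 word_cat_consS wE.
rewrite -cat1s word_cat_cat wE.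
case: l l0 ld {wE} => [|[e [//|k]] l] /= l0 ld.
  rewrite word_cat_nil le_eqVlt => /predU1P[/Q1R_inj ->|cd].
    exists [::], d; split=> //; apply: funext => -[|k]//=.
    by rewrite word_cat_consS !word_cat_nil.
  by exists [:: (c, 1%N)], d; split=> //=; rewrite -(@ltQ1R R) cd.
rewrite word_cat_cons0 le_eqVlt => /predU1P[/Q1R_inj ->|ce].
  exists ((e, k.+2) :: l), d; split=> //=.
  by rewrite -[in RHS]cat1s word_cat_cat.
exists ((c, 1%N) :: (e, k.+1) :: l), d; split=> //=.
  by rewrite -(@ltQ1R R) ce.
by rewrite -[in RHS]cat1s word_cat_cat.
Qed.

Lemma HQBerk_sub : H `<=` P.
Proof. by move=> x []. Qed.

Lemma cylinder_HQBerk alpha beta :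
  cylinder P alpha beta `&` H = cylinder H alpha beta.
Proof.
apply/seteqP; split=> [y [[x [-> Pbx Pax] Hbx]]|_ [x [-> Hbx Hax]]]; last first.
  by split=> //; exists x; split=> //; exact: HQBerk_sub.
exists x; split=> //; apply/HQBerkE; split=> //.
have /HQBerkE[_ [w [a bxE]]] := Hbx.
exists (alpha ++ drop (size beta) w), a; rewrite word_cat_cat; congr word_cat.
apply/funext => k; rewrite -(word_cat_shift beta) bxE.
by rewrite /word_cat map_drop nth_drop.
Qed.

(** * Finitely determined sets *)

(** The finitely many bits of [y] that a set of the cylinder algebra can see. *)
Definition agree (F : seq Q1) (n : nat) (y z : nat -> R) :=
  forall k a, (k <= n)%N -> a \in F ->
    (y k = Q1R a <-> z k = Q1R a) /\
    (comb q b (y k) (Q1R a) <-> comb q b (z k) (Q1R a)).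

Definition finitely_determined (E : set (nat -> R)) :=
  E `<=` P /\ exists F n, forall y z, P y -> P z -> agree F n y z ->
    (E y <-> E z).

Lemma agree_sym F n y z : agree F n y z -> agree F n z y.
Proof.
by move=> yz k a kn aF; have [e c] := yz k a kn aF; split; exact: iff_sym.
Qed.

Lemma agree_sub (F G : seq Q1) m n y z : {subset F <= G} -> (m <= n)%N ->
  agree G n y z -> agree F m y z.
Proof.
by move=> FG mn yz k a km aF; apply: yz (FG _ aF); exact: leq_trans mn.
Qed.

Lemma finitely_determined_boolean : boolean_algebra_on P finitely_determined.
Proof.
have common E E' : finitely_determined E -> finitely_determined E' ->
    exists F n, forall y z, P y -> P z -> agree F n y z ->
      (E y <-> E z) /\ (E' y <-> E' z).
  move=> [_ [F [n Edet]]] [_ [F' [n' E'det]]].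
  exists (F ++ F'), (maxn n n') => y z Py Pz yz.
  split; [apply: Edet|apply: E'det] => //; apply: agree_sub yz.
  - by move=> a aF; rewrite mem_cat aF.
  - exact: leq_maxl.
  - by move=> a aF; rewrite mem_cat aF orbT.
  - exact: leq_maxr.
split.
- by move=> E [].
- by split=> //; exists [::], 0%N.
- move=> E E' dE dE'; have [F [n EE']] := common _ _ dE dE'.
  case: dE dE' => [EP _] [E'P _]; split; first by rewrite subUset.
  exists F, n => y z Py Pz yz; have [] := EE' y z Py Pz yz.
  by rewrite /setU /=; tauto.
- move=> E E' dE dE'; have [F [n EE']] := common _ _ dE dE'.
  case: dE dE' => [EP _] [E'P _]; split.
    exact: subset_trans (@subIsetl _ _ _) EP.
  exists F, n => y z Py Pz yz; have [] := EE' y z Py Pz yz.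
  by rewrite /setI /=; tauto.
- move=> E [EP [F [n Edet]]]; split; first exact: subDsetl.
  exists F, n => y z Py Pz yz; have := Edet y z Py Pz yz.
  by rewrite /setD /=; tauto.
Qed.

(** A prefix in front of a sequence only constrains the first term of that
    sequence, through the comb relation at the last letter; asking for the
    hypothesis at every letter spares naming the last one. *)
Lemma P1Berk_word_cat w x y : P y ->
  {in w, forall a, comb q b (x 0%N) (Q1R a) -> comb q b (y 0%N) (Q1R a)} ->
  P (word_cat w x) -> P (word_cat w y).
Proof.
move=> Py; elim: w => [|a w IHw] xy; first by rewrite !word_cat_nil.
rewrite -cat1s !word_cat_cat => /P1Berk_cons[xa Px]; apply/P1Berk_cons.
split; last by apply: IHw Px => c cw; apply: xy; rewrite inE cw orbT.
case: w xa {IHw Px} xy => [|c w] //; rewrite !word_cat_nil => xa xy.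
by apply: xy xa; exact: mem_head.
Qed.

Lemma finitely_determined_cylinder alpha beta :
  finitely_determined (cylinder P alpha beta).
Proof.
split; first exact: cylinder_sub.
exists (alpha ++ beta), (size beta).
suff half y z : P z -> agree (alpha ++ beta) (size beta) y z ->
    cylinder P alpha beta y -> cylinder P alpha beta z.
  move=> y z Py Pz yz; split; apply: half => //.
  exact: agree_sym.
move=> Pz yz [x [yE Pbx Pax]].
pose x' k := z (size beta + k)%N.
have zE : z = word_cat beta x'.
  apply/funext => k; have [kb|bk] := ltnP k (size beta); last first.
    by rewrite -[in RHS](subnKC bk) word_cat_shift /x' subnKC.
  have wE u : word_cat beta u k = Q1R (nth (q 0%N) beta k) :> R.
    by rewrite /word_cat (nth_map (q 0%N)).
  rewrite wE; apply: (yz k _ _ _).1.1; first exact: ltnW.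
    by rewrite mem_cat mem_nth// orbT.
  by rewrite yE wE.
exists x'; split=> //; first by rewrite -zE.
apply: P1Berk_word_cat Pax.
  by move=> k; have := Pz (size beta + k)%N; rewrite /x' addnS.
move=> a aal; rewrite /x' addn0 => xa.
apply: (yz (size beta) a _ _).2.1 => //; first by rewrite mem_cat aal.
by rewrite yE -[size beta]addn0 word_cat_shift.
Qed.

Lemma finitely_determined_cylinder_algebra (L : set (seq Q1)) :
  cylinder_algebra P L `<=` finitely_determined.
Proof.
apply: cylinder_algebra_ind => [|al be _ _].
  exact: finitely_determined_boolean.
exact: finitely_determined_cylinder.
Qed.

(** * Density of the type II points *)

Lemma Q1R_between (l u : R) : 0 <= l -> u <= 1 -> l < u ->
  exists c : Q1, l < Q1R c < u.
Proof.
move=> l0 u1 /rat_in_itvoo[r]; rewrite in_itv/= => /andP[lr ru].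
have r01 : 0 < r < 1.
  rewrite -(ltr0q R) -(ltr_rat R r 1) rmorph1.
  by rewrite (le_lt_trans l0 lr) (lt_le_trans ru u1).
by exists (exist _ r r01); rewrite /Q1R /= lr ru.
Qed.

(** Membership in the tooth at [a] is constant on an interval ending at [t] and
    open on its left: it starts at [b n] if [t] is beyond the tooth, and at the
    left end [a] if [t] is on it. *)
Lemma agree_below t (F : seq Q1) : 0 < t -> (forall a, t <> Q1R a) ->
  exists2 l, 0 <= l < t & forall c, l < Q1R c < t ->
    {in F, forall a, c <> a /\
      (comb q b t (Q1R a) <-> comb q b (Q1R c) (Q1R a))}.
Proof.
move=> t0 tQ; elim: F => [|a F [l /andP[l0 lt] IHF]].
  by exists 0; rewrite ?lexx.
have [q' qK q'K] := q_enum; pose n := q' a.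
suff [m /andP[m0 mt] mP] : exists2 m, 0 <= m < t & forall c, m < Q1R c < t ->
    c <> a /\ (comb q b t (Q1R a) <-> comb q b (Q1R c) (Q1R a)).
  exists (Num.max l m); first by rewrite le_max l0 gt_max lt.
  move=> c; rewrite gt_max => /andP[/andP[lc mc] ct] d.
  rewrite inE => /predU1P[->|dF]; first by apply: mP; rewrite mc.
  by apply: IHF dF; rewrite lc.
rewrite -(q'K a) -/n; have [tq|qt|tqE] := ltgtP t (Q1R (q n)).
- exists 0; rewrite ?lexx// => c /andP[c0 ct]; split.
    by move=> cq; move: (lt_trans ct tq); rewrite cq ltxx.
  rewrite !comb_q !in_itv/= [Q1R (q n) <= t]leNgt tq.
  by rewrite [Q1R (q n) <= Q1R c]leNgt (lt_trans ct tq).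
- have [tb|bt] := leP t (b n).
    exists (Q1R (q n)); first by rewrite ltW ?Q1R_gt0.
    move=> c /andP[qc ct]; split; first by move=> cq; move: qc; rewrite cq ltxx.
    by rewrite !comb_q !in_itv/= tb (ltW qt) (ltW qc) (le_trans (ltW ct) tb).
  exists (b n).
    by rewrite (le_trans (ltW (Q1R_gt0 (q n))) (ltW (ltqb n))).
  move=> c /andP[bc ct]; split.
    by move=> cq; move: (lt_trans (ltqb n) bc); rewrite cq ltxx.
  by rewrite !comb_q !in_itv/= [t <= _]leNgt bt [Q1R c <= _]leNgt bc !andbF.
- by case: (tQ _ tqE).
Qed.

(** Below all the letters of [F], no tooth of [F] is met. *)
Lemma agree_above0 (F : seq Q1) :
  exists2 u : R, 0 < u <= 1 & forall c, Q1R c < u ->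
    {in F, forall a, c <> a /\
      (comb q b 0 (Q1R a) <-> comb q b (Q1R c) (Q1R a))}.
Proof.
elim: F => [|a F [u /andP[u0 u1] IHF]].
  by exists 1; rewrite ?ltr01 ?lexx.
exists (Num.min u (Q1R a)); first by rewrite lt_min u0 Q1R_gt0 ge_min u1.
move=> c; rewrite lt_min => /andP[cu ca] d.
rewrite inE => /predU1P[->|dF]; last exact: IHF dF.
split; first by move=> ca'; move: ca; rewrite ca' ltxx.
by split=> /comb_le; rewrite leNgt ?Q1R_gt0 ?ca.
Qed.

Lemma agree_const t (F : seq Q1) : t \in `[0, 1] ->
  (forall a, t <> Q1R a) ->
  exists c, forall n, agree F n (fun=> t) (fun=> Q1R c).
Proof.
move=> t01 tQ.
suff [c cP] : exists c, {in F, forall a, c <> a /\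
    (comb q b t (Q1R a) <-> comb q b (Q1R c) (Q1R a))}.
  exists c => n k a _ aF; have [ca cta] := cP a aF; split=> //.
  by split=> [/tQ//|/Q1R_inj].
move: t01; rewrite in_itv/= le_eqVlt => /andP[/predU1P[t0|t0] t1].
  have [u /andP[u0 u1] uP] := agree_above0 F.
  have [c /andP[_ cu]] := Q1R_between (lexx 0) u1 u0.
  by exists c; rewrite -t0; exact: uP.
have [l /andP[l0 lt] lP] := agree_below F t0 tQ.
by have [c lct] := Q1R_between l0 t1 lt; exists c; exact: lP.
Qed.

Lemma HQBerk_const a : H (fun=> Q1R a).
Proof.
apply/HQBerkE; split; first by apply: P1Berk_const; exact: Q1R_itv.
by exists [::], a; rewrite word_cat_nil.
Qed.

Lemma HQBerk_dense_notin_Q1 (F : seq Q1) n x : P x ->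
  (forall a, x 0%N <> Q1R a) -> exists2 z, H z & agree F n x z.
Proof.
move=> Px xQ; have [c xc] := agree_const F (Px 0%N).1 xQ.
exists (fun=> Q1R c); first exact: HQBerk_const.
by rewrite (P1Berk_notin_Q1 Px xQ); exact: xc.
Qed.

Lemma HQBerk_dense (F : seq Q1) n y : P y -> exists2 z, H z & agree F n y z.
Proof.
elim: n F y => [|n IHn] F y Py;
  (have [[a ya]|/forallNP yQ] := pselect (exists a, y 0%N = Q1R a);
    last exact: HQBerk_dense_notin_Q1).
- exists (fun=> Q1R a); first exact: HQBerk_const.
  by move=> k d; rewrite leqn0 => /eqP -> _; rewrite ya.
- (* The tail must also remember whether [a] may precede it. *)
  have [z /HQBerkE[Pz [w [c zE]]] yz] := IHn (a :: F) _ (P1BerkS Py).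
  exists (word_cat [:: a] z).
    apply/HQBerkE; split; last first.
      by exists (a :: w), c; rewrite -[in RHS]cat1s word_cat_cat -zE.
    apply/P1Berk_cons; split=> //.
    apply: (yz 0%N a _ _).2.1 => //; first exact: mem_head.
    by rewrite -ya; case: (Py 0%N).
  move=> [|k] d kn dF; first by rewrite ya.
  rewrite word_cat_consS word_cat_nil; apply: yz => //.
  by rewrite inE dF orbT.
Qed.

(** A nonempty set of the algebra contains, with one of its points, the points
    of [H] that agree with it on the bits that determine the set. *)
Lemma cylinder_algebra_trace_eq0 (L : set (seq Q1)) E :
  cylinder_algebra P L E -> E `&` H = set0 -> E = set0.
Proof.
move=> /finitely_determined_cylinder_algebra[EP [F [n Edet]]] EH0.
rewrite -subset0 => y Ey.
have [z Hz yz] := HQBerk_dense F n (EP _ Ey).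
rewrite -EH0; suff: (E `&` H) z by rewrite EH0.
by split=> //; apply/(Edet y z (EP _ Ey) (HQBerk_sub Hz) yz).
Qed.

End dendrite.

Theorem theorem5p1 (R : realType) (q : nat -> Q1) (b : nat -> R)
  (q_enum : bijective q)
  (b01 : forall n, b n \in `[0, 1])
  (ltqb : forall n, Q1R (q n) < b n)
  (lim_bq : (fun n => b n - Q1R (q n)) @ \oo --> (0 : R))
  (OP : cstarAlgType R) (pP : set (nat -> R) -> OP) (sP : Q1 -> OP)
  (OH : cstarAlgType R) (pH : set (nat -> R) -> OH) (sH : Q1 -> OH)
  (univP : universal_algebra (P1Berk q b) (language q b) pP sP)
  (univH : universal_algebra (HQBerk q b) (language q b) pH sH) :
  star_isomorphic OP OH.
Proof.
apply: universal_algebra_trace univP univH.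
- exact: HQBerk_sub.
- by move=> alpha beta _ _; exact: cylinder_HQBerk.
- move=> E; exact: cylinder_algebra_trace_eq0.
Qed.
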